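(* Let $D(X)\in\mathbb Z[X]$ be a polynomial and, for $x\in\mathbb N$ with $D(x)>0$, let $\varepsilon(x)$ be the fundamental unit of $\mathbb Q(\sqrt{D(x)})$. Assume that for a positive density of $x\in\mathbb N$ we have that $D(x)$ is squarefree and $\varepsilon(x)\ll D(x)^{1/2}$. Then there are $k(X)\in\mathbb Q[X]$ and $u_1, \dots, u_{s-1}\in\mathbb Z$ such that $$\sqrt {D(x)}=[k(x), \overline{u_1, u_2, \dots, u_{s-1}, 2k(x)}]\quad\text{or}\quad \frac{1+\sqrt {D(x)}}2=[k(x), \overline{u_1, u_2, \dots, u_{s-1}, 2k(x)-1}]$$ for each $x\in\mathbb N$ with $D(x),k(x)\in\mathbb N$.
   Context: $\mathbb N$ is the set of positive integers. The fundamental unit of a real quadratic field is taken to be $>1$. The hypothesis means that there is a constant $C>0$ such that the set of $x\in\mathbb N$ for which $D(x)$ is positive and squarefree and $\varepsilon(x)\le C\,D(x)^{1/2}$ has positive density in $\mathbb N$. The notation $[k,\overline{u_1,\dots,u_s}]$ denotes the periodic continued fraction with initial term $k$ and repeating block $u_1,\dots,u_s$. *)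

(* Defs.v *)
From HB Require Import structures.
From mathcomp Require Import all_boot all_order all_algebra.
From mathcomp Require Import all_classical all_reals all_analysis.
Set Implicit Arguments.
Unset Strict Implicit.
Unset Printing Implicit Defensive.
Import Order.TTheory GRing.Theory Num.Theory.
Import numFieldNormedType.Exports.
Local Open Scope classical_set_scope.
Local Open Scope ring_scope.

(* Positive upper density: the limit superior of #(A `&` {1, .., n}) / n is
   positive.  It coincides with positive natural density when the natural
   density exists, and follows from positive lower density. *)
Definition positive_density (R : realType) (A : set nat) : Prop :=
  0 < limn_sup (fun n : nat => (count (mem A) (iota 1 n))%:R / n%:R : R).

Definition squarefree (d : int) : Prop :=
  forall p : nat, prime p -> ~~ (p ^ 2 %| `|d|)%N.

(* The field Q(sqrt d), d > 0, inside the reals. *)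
Definition quad_field (R : realType) (d : int) : set R :=
  [set z | exists a b : rat, z = ratr a + ratr b * Num.sqrt d%:~R].

(* Units of the ring of integers of Q(sqrt d). *)
Definition quad_unit (R : realType) (d : int) (z : R) : Prop :=
  [/\ quad_field d z, z != 0,
      integralOver (intr : int -> R) z & integralOver (intr : int -> R) z^-1].

(* [e] is unique if it exists; when d is a perfect square the field is Q,
   whose only units are 1 and -1, and no [e] satisfies the predicate. *)
Definition fundamental_unit (R : realType) (d : int) (e : R) : Prop :=
  [/\ quad_unit d e, 1 < e &
      forall z : R, quad_unit d z -> exists n : int, z = e ^ n \/ z = - e ^ n].

(* contfrac_conv R a n = a 0 + 1 / (a 1 + 1 / (.. + 1 / a n)) *)
Fixpoint contfrac_conv (R : realType) (a : nat -> int) (n : nat) : R :=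
  if n is n'.+1 then (a 0%N)%:~R + (contfrac_conv R (a \o succn) n')^-1
  else (a 0%N)%:~R.

(* y = [a 0; a 1, a 2, ...] as an infinite regular continued fraction. *)
Definition is_contfrac (R : realType) (a : nat -> int) (y : R) : Prop :=
  (forall n : nat, 0 < a n.+1) /\ contfrac_conv R a @ \oo --> y.

(* The partial quotients of [k, \overline{v}]; the block v is meant nonempty. *)
Definition periodic_quotients (k : int) (v : seq int) (n : nat) : int :=
  if n is m.+1 then nth 0 v (m %% size v) else k.

(* x, D(x) and k(x) are positive integers, the last one being m. *)
Definition admissible (D : {poly int}) (k : {poly rat}) (x m : nat) : Prop :=
  [/\ (0 < x)%N, 0 < D.[x%:Z], (0 < m)%N & k.[x%:R] = m%:R].

(* Main.v *)
Require Import Defs.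
From mathcomp Require Import all_boot all_order all_algebra.
From mathcomp Require Import all_classical all_reals all_analysis.
From mathcomp Require polyrcf.
From mathcomp Require Import zify ring lra.
Set Implicit Arguments.
Unset Strict Implicit.
Unset Printing Implicit Defensive.
Import Order.TTheory GRing.Theory Num.Theory.
Import numFieldNormedType.Exports.
Local Open Scope classical_set_scope.
Local Open Scope ring_scope.

(** Write a unit [e > 1] of [Q(sqrt D(x))] as [(a + b sqrt D(x)) / 2] with
    [a ^ 2 = b ^ 2 D(x) + 4 s], [s] its norm.  If [e] is at most a constant
    times [sqrt D(x)], then [b] is bounded (quad_unit_pell), so the set of good
    [x] is coloured by the finitely many pairs [(b, s)].  Positive density
    yields one colour and one distance [h] such that [x] and [x + h] both have
    this colour for infinitely many [x] (positive_density_pair); thus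
    [F = b ^ 2 D + 4 s] takes square values at infinitely many pairs
    [x, x + h].

    The polynomial [F] is then a square (square_poly_of_pairs).  The product
    [F(X) F(X + h)] has even degree and a square leading coefficient, so it has
    a square root up to an error of degree smaller than that of the root, and
    comparison of integers shows that the error is zero.  A nonconstant
    polynomial without square factors is not periodic, so [F(X) F(X + h)] being
    a square forces [F] to be a constant times a square, and one nonzero square
    value makes this constant a square.

    Hence [G ^ 2 = b ^ 2 D + 4 s] in [Q[X]], a Pell equation solved identically
    in [X].  Put [t = 1] if [b] is odd and [t = 0] otherwise, [Q = b] or
    [Q = b / 2] accordingly, and let [y] be [(1 + sqrt D) / 2] or [sqrt D].
    For infinitely many [x] the number [p = (+-G(x) + t Q) / 2] is an integer in
    a fixed residue class, [p = Q m + c] with [m > 0] (pell_residue and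
    inf_often_pigeonhole).  The matrix [[Q, c], [c, c']] with [Q c' = c ^ 2 - s]
    does not depend on [x]; its expansion into partial quotients [u]
    (contfrac_tail_mobius) together with the Pell equation gives
    [y = m + 1 / [u, y + m - t]], which is the periodic expansion of [y] with
    period [u, 2 m - t] (contfrac_of_unit).  So [k = (p - c) / Q], and the
    identity holds for every [x] at which [k(x) = m] is a positive integer. *)

(** * Infinitely many natural numbers *)

Definition inf_often (P : nat -> Prop) : Prop :=
  forall N, exists2 n, (N <= n)%N & P n.

Lemma inf_often_impl (P Q : nat -> Prop) :
  (forall n, P n -> Q n) -> inf_often P -> inf_often Q.
Proof. by move=> PQ hP N; have [n Nn /PQ Qn] := hP N; exists n. Qed.

Lemma inf_often_pigeonhole (I : finType) (P : nat -> Prop) (S : I -> nat -> Prop) :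
  inf_often P -> (forall n, P n -> exists i, S i n) -> exists i, inf_often (S i).
Proof.
move=> hP PS; apply: contrapT => /forallNP noS.
have {}noS i : exists N, forall n, (N <= n)%N -> ~ S i n.
  have /existsNP[N /forall2NP hN] := noS i.
  by exists N => n Nn; case: (hN n).
have [N hN] := choice noS.
have [n + /PS[i Sin]] := hP (\max_i N i).
by move=> /(leq_trans (leq_bigmax i))/hN.
Qed.

Lemma inf_often_infinite (A : set nat) : inf_often A -> infinite_set A.
Proof.
move=> hA /finite_seqP[s As]; have [n + An] := hA (\max_(x <- s) x).+1.
suff : (n <= \max_(x <- s) x)%N by lia.
by rewrite leq_bigmax_seq //; move: An; rewrite As.
Qed.

(** * Polynomials taking square values *)

Lemma poly_eventually_gt0 (p : {poly rat}) :
  0 < lead_coef p -> exists N, forall n, (N <= n)%N -> 0 < p.[n%:R].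
Proof.
move=> lc0; have [y hy] := polyrcf.poly_pinfty_gt_lc lc0.
exists (Num.bound y) => n Nn; apply: lt_le_trans lc0 (hy _ _).
apply: le_trans (ler_norm _) _; apply: ltW.
by apply: lt_le_trans (archi_boundP (normr_ge0 y)) _;
  rewrite ?ler_nat // /Num.bound normr_id.
Qed.

Lemma poly_eventually_lt (p q : {poly rat}) : (size p < size q)%N ->
  exists N, forall n, (N <= n)%N -> `|p.[n%:R]| < `|q.[n%:R]|.
Proof.
move=> spq; have q0 : q != 0 by rewrite -size_poly_gt0 (leq_ltn_trans _ spq).
have sq2 : (size (- p ^+ 2)%R < size (q ^+ 2)%R)%N.
  rewrite size_polyN; have [->|p0] := eqVneq p 0.
    by rewrite expr0n size_poly0 size_poly_gt0 expf_neq0.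
  move: spq (p0); rewrite !expr2 !size_mul // -!size_poly_gt0.
  by move: (size p) (size q) => sp sq; lia.
have [|N hN] := @poly_eventually_gt0 (q ^+ 2 - p ^+ 2).
  by rewrite lead_coefDl // lead_coef_exp exprn_even_gt0 // lead_coef_eq0.
exists N => n /hN; rewrite hornerD hornerN !horner_exp subr_gt0.
rewrite -(real_normK (num_real p.[_])) -(real_normK (num_real q.[_])).
by rewrite ltr_pXn2r ?nnegrE ?normr_ge0.
Qed.

Lemma poly_eq0_inf_often (p : {poly rat}) :
  inf_often (fun n => p.[n%:R] = 0) -> p = 0.
Proof.
move=> hp; apply/eqP/negPn/negP => p0.
have [|N hN] := @poly_eventually_lt 0 p; first by rewrite size_poly0 size_poly_gt0.
by have [n /hN + pn] := hp N; rewrite pn horner0 ltxx.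
Qed.

(** Completing the square from the top: each coefficient of the root below the
    leading one is chosen to cancel the next coefficient of the error. *)
Lemma poly_sqrt_approx (F : {poly rat}) (d : nat) (a : rat) :
    a != 0 -> (size F <= d.*2.+1)%N -> F`_d.*2 = a ^+ 2 ->
  exists2 g : {poly rat}, size g = d.+1 & (size (F - g ^+ 2)%R <= d)%N.
Proof.
move=> a0 sF Fa.
suff /(_ d (leqnn d))[g [sg _ hg]] : forall e, (e <= d)%N -> exists g : {poly rat},
    [/\ size g = d.+1, g`_d = a & (size (F - g ^+ 2)%R <= d.*2 - e)%N].
  by exists g => //; move: hg; rewrite -addnn addnK.
elim=> [_|e IHe ed].
  exists (a *: 'X^d).
  rewrite size_scale // size_polyXn coefZ coefXn eqxx mulr1 subn0; split=> //.
  apply/leq_sizeP => j; rewrite leq_eqVlt => /predU1P[<-|jd].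
    by rewrite coefB Fa exprZn -exprM muln2 coefZ coefXn eqxx mulr1 subrr.
  rewrite coefB exprZn -exprM muln2 coefZ coefXn gtn_eqF // mulr0 subr0.
  by apply: (leq_sizeP _ _ sF).
have [g [sg ga hg]] := IHe (ltnW ed).
set r := F - g ^+ 2 in hg; set i := (d.*2 - e.+1)%N.
have id : (d <= i)%N by rewrite /i; lia.
pose h : {poly rat} := (r`_i / (a *+ 2)) *: 'X^(i - d).
exists (g + h).
have sh : (size h < size g)%N.
  by rewrite (leq_ltn_trans (size_scale_leq _ _)) // size_polyXn sg /i; lia.
split.
- by rewrite size_polyDl.
- by rewrite coefD ga coefZ coefXn gtn_eqF ?mulr0 ?addr0 // /i; lia.
have -> : F - (g + h) ^+ 2 = r - (g * h *+ 2 + h ^+ 2) by rewrite /r; ring.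
clearbody r; apply/leq_sizeP => j ij.
have h2 : (h ^+ 2)`_j = 0.
  apply/leq_sizeP: ij.
  by rewrite exprZn (leq_trans (size_scale_leq _ _)) // -exprM size_polyXn /i; lia.
rewrite coefB coefD h2 addr0 coefMn -scalerAr coefZ coefMXn.
move: ij; rewrite leq_eqVlt => /predU1P[<-|ij].
  rewrite ltnNge leq_subLR leq_addl /= subKn // ga.
  by field.
rewrite ltnNge (leq_trans (leq_subr _ _) (ltnW ij)) /=.
have -> : r`_j = 0 by apply: (leq_sizeP _ _ hg); move: ij; rewrite /i; lia.
rewrite (_ : g`_(j - (i - d)) = 0) ?mulr0 ?mul0rn ?subr0 //.
by apply: nth_default; rewrite sg; lia.
Qed.

Lemma int_sqr_gap (u v : int) : u ^+ 2 != v ^+ 2 -> `|v| <= `|u ^+ 2 - v ^+ 2|.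
Proof.
rewrite -subr_eq0 subr_sqr mulf_eq0 negb_or normrM => /andP[p0 q0].
have : 0 < `|u - v| by rewrite normr_gt0.
have : 0 < `|u + v| by rewrite normr_gt0.
have : `|v| *+ 2 <= `|u - v| + `|u + v| by lia.
by move: `|u - v| `|u + v| `|v| => p q w; nia.
Qed.

(** Completing the square leaves an error of smaller degree than the root.
    After clearing denominators, two integers whose squares differ by less than
    their size are equal up to sign, so the error vanishes infinitely often. *)
Lemma poly_square_of_values (F : {poly int}) (d : nat) (a : int) :
    a != 0 -> (size F <= d.*2.+1)%N -> F`_d.*2 = a ^+ 2 ->
    inf_often (fun n => exists y : int, F.[n%:Z] = y ^+ 2) ->
  exists g : {poly rat}, map_poly intr F = g ^+ 2.
Proof.
move=> a0 sF Fa hF; set f : {poly rat} := map_poly intr F.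
have [|||g sg hr] := @poly_sqrt_approx f d a%:~R.
- by rewrite intr_eq0.
- by rewrite size_rat_int_poly.
- by rewrite coef_map Fa /= -rmorphXn.
exists g; apply/eqP; rewrite -subr_eq0; apply/eqP.
set r := f - g ^+ 2 in hr *.
have [G [b b0 gE]] := rat_poly_scale g.
have [|N hN] := @poly_eventually_lt (b%:~R *: r) g.
  by rewrite sg ltnS (leq_trans (size_scale_leq _ _)).
apply: poly_eq0_inf_often => M.
have [n + [y Fy]] := hF (maxn M N); rewrite geq_max => /andP[Mn /hN {}hN].
exists n => //.
have fn : f.[n%:R] = y%:~R ^+ 2 by rewrite -(rmorphXn intr) -Fy -horner_map.
have gn : b%:~R * g.[n%:R] = G.[n%:Z]%:~R.
  by rewrite gE hornerZ mulrA divff ?intr_eq0 // mul1r -horner_map.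
have rn : b%:~R ^+ 2 * r.[n%:R] = ((b * y) ^+ 2 - G.[n%:Z] ^+ 2)%:~R.
  by rewrite rmorphB !rmorphXn /= rmorphM /= -gn !hornerE fn; ring.
set z := (_ - _ ^+ 2) in rn.
have [z0|z0] := eqVneq z 0.
  move: rn; rewrite z0 => /eqP.
  by rewrite mulf_eq0 expf_eq0 intr_eq0 (negPf b0) => /eqP.
have : `|G.[n%:Z]| <= `|z|.
  by apply: int_sqr_gap; rewrite -subr_eq0.
rewrite -(ler_int rat) !intr_norm -gn -rn expr2 -mulrA !normrM.
rewrite ler_pM2l ?normr_gt0 ?intr_eq0 // -normrM -hornerZ.
by rewrite leNgt hN.
Qed.

(** With [t = gcdp a g], the square of a Bezout relation for [t] shows that [a]
    divides [t ^ 2], because [g ^ 2] is a multiple of [a]; conversely [t ^ 2]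
    divides [a * b] and is coprime to [b]. *)
Lemma coprimep_mul_sqr (F : fieldType) (a b g : {poly F}) :
  coprimep a b -> a * b = g ^+ 2 -> gcdp a g ^+ 2 %= a.
Proof.
move=> cab abg; apply/andP; split.
  have cb : coprimep (gcdp a g ^+ 2) b.
    by rewrite coprimep_expl // (coprimep_dvdr (dvdp_gcdl _ _)).
  by rewrite -(Gauss_dvdpl _ cb) abg dvdp_exp2r ?dvdp_gcdr.
have [[u v] /= huv] := Bezoutp a g.
rewrite -(eqp_dvdr _ (eqp_exp 2 huv)).
have -> : (u * a + v * g) ^+ 2
    = (u ^+ 2 * a + u * v * g *+ 2 + v ^+ 2 * b) * a.
  transitivity (u ^+ 2 * a ^+ 2 + (u * v * g *+ 2) * a + v ^+ 2 * g ^+ 2).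
    by ring.
  by rewrite -abg; ring.
exact: dvdp_mull.
Qed.

Definition shiftp (h : nat) (p : {poly rat}) : {poly rat} := p \Po ('X + h%:R%:P).

Lemma size_shiftp h p : size (shiftp h p) = size p.
Proof. by rewrite size_comp_poly2 // -[h%:R]opprK polyCN size_XsubC. Qed.

Lemma shiftp_eq0 h p : (shiftp h p == 0) = (p == 0).
Proof. by rewrite -!size_poly_eq0 size_shiftp. Qed.

Lemma lead_coef_shiftp h p : lead_coef (shiftp h p) = lead_coef p.
Proof.
rewrite lead_coef_comp -[h%:R]opprK polyCN ?size_XsubC // lead_coefXsubC.
by rewrite expr1n mulr1.
Qed.

Lemma shiftpM h p q : shiftp h (p * q) = shiftp h p * shiftp h q.
Proof. exact: comp_polyM. Qed.

Lemma horner_shiftp h p n : (shiftp h p).[n%:R] = p.[(n + h)%:R].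
Proof. by rewrite horner_comp !hornerE natrD. Qed.

(** The value at [0] is taken again at all multiples of the period. *)
Lemma shiftp_fixed h p : (0 < h)%N -> shiftp h p = p -> p = p.[0]%:P.
Proof.
move=> h0 ph; apply/eqP; rewrite -subr_eq0; apply/eqP.
apply: poly_eq0_inf_often => N; exists (N * h)%N; first by rewrite leq_pmulr.
rewrite hornerD hornerN hornerC; apply/eqP; rewrite subr_eq0; apply/eqP.
by elim: N => [|N IH]; rewrite ?mul0n // mulSn addnC -horner_shiftp ph.
Qed.

(** Suppose first that [f] has no square factor.  Writing [f = w * a] and
    [shiftp h f = w * b] with [w] their gcd, the coprime product [a * b] is a
    square, so [a] is a square up to a constant and hence constant; thus [f]
    equals its own shift, and a polynomial with a period is constant.  Square
    factors are split off by induction on the degree. *)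
Lemma mul_shiftp_sqr h (f g : {poly rat}) : (0 < h)%N ->
  f * shiftp h f = g ^+ 2 -> exists c t, f = c *: t ^+ 2.
Proof.
move=> h0; have [n] := ubnP (size f); elim: n f g => // n IHn f g.
rewrite ltnS => sfn ffh.
have [->|f0] := eqVneq f 0; first by exists 0, 0; rewrite scale0r.
have fh0 : shiftp h f != 0 by rewrite shiftp_eq0.
set w := gcdp f (shiftp h f).
have w0 : w != 0 by rewrite gcdp_eq0 negb_and f0.
have /dvdpP[a fE] : w %| f by apply: dvdp_gcdl.
have /dvdpP[b fhE] : w %| shiftp h f by apply: dvdp_gcdr.
have cab : coprimep a b.
  have := coprimep_div_gcd (p := f) (q := shiftp h f).
  by rewrite f0 -/w => /(_ isT); rewrite fhE {1}fE !mulpK.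
have /dvdpP[G gE] : w %| g.
  rewrite -(dvdp_pexp2r _ _ (k := 2)) // -ffh expr2.
  by rewrite dvdp_mul ?dvdp_gcdl ?dvdp_gcdr.
have abG : a * b = G ^+ 2.
  have w20 : w ^+ 2 != 0 by rewrite expf_neq0.
  by apply: (mulIf w20); rewrite -exprMn -gE -ffh {1}fE fhE; ring.
have a0 : a != 0 by apply: contraNneq f0 => a0; rewrite fE a0 mul0r.
have at2 := coprimep_mul_sqr cab abG; set t := gcdp a G in at2.
have [st|st] := leqP (size t) 1.
  have sa : (size a <= 1)%N.
    rewrite -(eqp_size at2) expr2 (leq_trans (size_polyMleq _ _)) //.
    by move: (size t) st; lia.
  have ffhd : f %| shiftp h f.
    have fw : f = a`_0 *: w by rewrite {1}fE {1}(size1_polyC sa) mul_polyC.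
    rewrite {1}fw dvdpZl ?dvdp_gcdr //.
    by move: a0; rewrite {1}(size1_polyC sa) polyC_eq0.
  have /eqp_eq : f %= shiftp h f.
    by rewrite -dvdp_size_eqp // size_shiftp.
  rewrite lead_coef_shiftp => fhf; have lf : lead_coef f != 0.
    by rewrite lead_coef_eq0.
  exists f.[0], 1; rewrite expr1n alg_polyC; apply: (shiftp_fixed h0).
  exact/esym/(scalerI lf).
have t0 : t != 0 by rewrite -size_poly_gt0 (ltn_trans _ st).
have t20 : t ^+ 2 != 0 by rewrite expf_neq0.
have /dvdpP[f1 f1E] : t ^+ 2 %| f.
  by rewrite (eqp_dvdl _ at2) fE dvdp_mulr.
have f10 : f1 != 0 by apply: contraNneq f0 => z; rewrite f1E z mul0r.
have /dvdpP[g1 g1E] : t * shiftp h t %| g.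
  rewrite -(dvdp_pexp2r _ _ (k := 2)) // -ffh f1E !shiftpM.
  by apply/dvdpP; exists (f1 * shiftp h f1); rewrite expr2; ring.
have f1g1 : f1 * shiftp h f1 = g1 ^+ 2.
  have tt0 : (t * shiftp h t) ^+ 2 != 0.
    by rewrite expf_neq0 // mulf_neq0 // shiftp_eq0.
  apply: (mulIf tt0); rewrite -exprMn -g1E -ffh f1E !shiftpM.
  by rewrite expr2; ring.
have [|c [t1 f1c]] := IHn f1 g1 _ f1g1.
  apply: leq_trans sfn; rewrite f1E size_mul // expr2 size_mul //.
  have := f10; rewrite -size_poly_gt0.
  by move: (size f1) (size t) st; lia.
by exists c, (t1 * t); rewrite f1E f1c -scalerAl exprMn.
Qed.

(** Single square values would not suffice: [2 X ^ 2 + 1] takes infinitely many of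
    them.  Pairs at a fixed distance [h] do, because [f(X) f(X + h)] has even
    degree and square leading coefficient, whatever [f] is. *)
Lemma square_poly_of_pairs (f : {poly int}) h : (0 < h)%N ->
    inf_often (fun n => (exists y : int, f.[n%:Z] = y ^+ 2) /\
                        exists y : int, f.[(n + h)%:Z] = y ^+ 2) ->
  exists g : {poly rat}, map_poly intr f = g ^+ 2.
Proof.
move=> h0 hf; have [->|f0] := eqVneq f 0.
  by exists 0; rewrite rmorph0 expr0n.
set p := map_poly _ f; pose q := 'X + (h%:Z)%:P : {poly int}.
have sq : size q = 2 by rewrite /q -[h%:Z]opprK polyCN size_XsubC.
have lq : lead_coef q = 1 by rewrite /q -[h%:Z]opprK polyCN lead_coefXsubC.
have p0 : p != 0 by rewrite -size_poly_eq0 size_rat_int_poly size_poly_eq0.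
have [g1 g1E] : exists g : {poly rat}, map_poly intr (f * (f \Po q)) = g ^+ 2.
  have sF : size (f * (f \Po q)) = (size f).-1.*2.+1.
    rewrite size_mul // -?size_poly_eq0 size_comp_poly2 // ?size_poly_eq0 //.
    by have := f0; rewrite -size_poly_gt0; move: (size f); lia.
  apply: (@poly_square_of_values _ (size f).-1 (lead_coef f)).
  - by rewrite lead_coef_eq0.
  - by rewrite sF.
  - have -> : (size f).-1.*2 = (size (f * (f \Po q))).-1 by rewrite sF.
    by rewrite -/(lead_coef _) lead_coefM lead_coef_comp ?sq // lq expr1n mulr1.
  - apply: inf_often_impl hf => n [[y ey] [z ez]]; exists (y * z).
    by rewrite hornerM horner_comp !hornerE ey -PoszD ez exprMn.
have [c [t pE]] : exists c t, p = c *: t ^+ 2.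
  apply: (@mul_shiftp_sqr h _ g1) => //; rewrite -g1E rmorphM /=; congr (_ * _).
  rewrite map_comp_poly; congr (_ \Po _).
  by rewrite rmorphD /= map_polyX map_polyC.
have t0 : t != 0 by apply: contraNneq p0 => t0; rewrite pE t0 expr0n scaler0.
have [|N hN] := @poly_eventually_lt 0 t; first by rewrite size_poly0 size_poly_gt0.
have [n /hN + [[y ey] _]] := hf N; rewrite horner0 normr0 normr_gt0 => tn.
have pn : c * t.[n%:R] ^+ 2 = y%:~R ^+ 2.
  by rewrite -horner_exp -hornerZ -pE -(rmorphXn intr) -ey -horner_map.
exists ((y%:~R / t.[n%:R]) *: t); rewrite pE exprZn; congr (_ *: _).
by rewrite expr_div_n -pn mulfK // expf_neq0.
Qed.

(** * Sets of positive density *)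

Lemma count_iota_windows (A : pred nat) (N H k q : nat) :
  (forall x, (N <= x)%N -> (count A (iota x H) <= k)%N) ->
  (count A (iota 0 (N + q * H)) <= N + q * k)%N.
Proof.
move=> hk; elim: q => [|q IHq].
  by rewrite !mul0n !addn0 -{2}(size_iota 0 N) count_size.
rewrite mulSnr addnA iotaD count_cat add0n mulSnr addnA leq_add // hk //.
exact: leq_addr.
Qed.

(** If in every colour equal-coloured pairs at each distance die out, then a
    window of length [H] far enough to the right meets [A] in at most one point
    of each colour, and [A] has density at most [#|K| / H] for every [H]. *)
Lemma positive_density_pair (R : realType) (A : set nat) (K : finType) (f : nat -> K) :
  positive_density R A ->
  exists i h, (0 < h)%N /\
    inf_often (fun n => [/\ A n, A (n + h)%N, f n = i & f (n + h)%N = i]).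
Proof.
apply: contraPP => /forallNP noP; apply/negP; rewrite -leNgt le_eqVlt.
apply/orP; left; apply/eqP.
have {}noP i h : exists N, forall n, (0 < h)%N -> (N <= n)%N ->
    ~ [/\ A n, A (n + h)%N, f n = i & f (n + h)%N = i].
  move: (noP i) => /forallNP/(_ h)/not_andP[h0|].
    by exists 0%N => n /h0.
  by move=> /existsNP[N /forall2NP hN]; exists N => n _ Nn; case: (hN n).
have {noP}[B hB] : exists B : K -> nat -> nat, forall i h n, (0 < h)%N ->
    (B i h <= n)%N -> ~ [/\ A n, A (n + h)%N, f n = i & f (n + h)%N = i].
  have [B hB] := choice (fun ih : K * nat => noP ih.1 ih.2).
  by exists (fun i h => B (i, h)) => i h n; apply: (hB (i, h)).
have window H : exists N, forall x, (N <= x)%N -> (count (mem A) (iota x H) <= #|K|)%N.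
  exists (\max_(i : K) \max_(h < H) B i h) => x Nx.
  rewrite -size_filter; set s := [seq _ <- _ | _].
  have su : uniq s by rewrite filter_uniq // iota_uniq.
  have fs : {in s &, injective f}.
    suff lt_neq p q : p \in s -> q \in s -> (p < q)%N -> f p <> f q.
      move=> p q ps qs fpq; have [pq|pq|//] := ltngtP p q.
        by case: (lt_neq _ _ ps qs pq).
      by case: (lt_neq _ _ qs ps pq).
    rewrite !mem_filter !mem_iota /= => /andP[/set_mem Ap px] /andP[/set_mem Aq qx] pq fpq.
    have pE : q = (p + (q - p))%N by lia.
    have hH : (q - p < H)%N by lia.
    have := hB (f p) (q - p)%N p; rewrite subn_gt0 -pE; apply => //.
    apply: leq_trans (leq_trans Nx (proj1 (andP px))).
    apply: leq_trans (leq_bigmax (F := fun i => \max_(h < H) B i h) (f p)).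
    exact: (leq_bigmax (F := fun h : 'I_H => B (f p) h) (Ordinal hH)).
  rewrite -(size_map f) -(card_uniqP _) ?map_inj_in_uniq //.
  exact: max_card.
suff u0 : (fun n => (count (mem A) (iota 1 n))%:R / n%:R : R) @ \oo --> (0 : R).
  by rewrite cvg_limn_supE; [apply/cvg_lim|apply/cvg_ex; exists 0].
apply/cvgr0Pnorm_le => e e0.
have e20 : 0 < e / 2 by lra.
have bnd (y : R) : exists2 m : nat, (0 < m)%N & y <= e / 2 * m%:R.
  exists (Num.bound (y / (e / 2))).+1 => //.
  rewrite mulrC -ler_pdivrMr // ltW //.
  apply: le_lt_trans (ler_norm _) _.
  apply: lt_le_trans (archi_boundP (normr_ge0 _)) _.
  by rewrite /Num.bound normr_id ler_nat.
have [H H0 HK] := bnd #|K|%:R.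
have [N hN] := window H.
have [M M0 hM] := bnd (N + #|K|)%:R.
exists M => // n /= Mn; have n0 : (0 < n)%N by apply: leq_trans Mn.
have nr0 : 0 < n%:R :> R by rewrite ltr0n.
rewrite ger0_norm ?divr_ge0 // ler_pdivrMr //.
pose q := (n %/ H)%N.
have qn : (q * H <= n)%N by apply: leq_trunc_div.
have nq : (n < q.+1 * H)%N by apply: ltn_ceil.
(* The first [N] numbers and [q + 1] windows cover [1 .. n]. *)
have cn : (count (mem A) (iota 1 n) <= N + #|K| + q * #|K|)%N.
  have := count_iota_windows q.+1 hN; rewrite (mulSn q #|K|) addnA; apply: leq_trans.
  have -> : (N + q.+1 * H = 1 + n + (N + q.+1 * H - n.+1))%N by lia.
  by rewrite !iotaD !count_cat add0n addnAC leq_addl.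
apply: le_trans (_ : (N + #|K| + q * #|K|)%:R <= _); first by rewrite ler_nat.
rewrite natrD natrM.
have M1 : M%:R <= n%:R :> R by rewrite ler_nat.
have q1 : q%:R * H%:R <= n%:R :> R by rewrite -natrM ler_nat.
have q0 : 0 <= q%:R :> R by [].
have := ler_wpM2l q0 HK; nra.
Qed.

(** * Units of real quadratic fields *)

(** Gauss's lemma: a rational multiple [q1] of [q] has integer coefficients and
    divides [p] over the integers, so its leading coefficient is a unit. *)
Lemma monic_dvdp_int (q : {poly rat}) (p : {poly int}) :
  q \is monic -> p \is monic -> q %| map_poly intr p ->
  forall i, q`_i \is a Num.int.
Proof.
move=> /monicP qm /monicP pm /dvdpP_rat_int[q1 [a a0 qE] [r pE]] i.
have lq1 : a * (lead_coef q1)%:~R = 1.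
  by have := qm; rewrite qE lead_coefZ lead_coef_map_inj //; apply: intr_inj.
have l1 : lead_coef q1 * lead_coef r = 1 by rewrite -lead_coefM -pE.
have -> : q`_i = (lead_coef r * q1`_i)%:~R.
  have -> : q`_i = a * (q1`_i)%:~R by rewrite qE coefZ coef_map.
  rewrite rmorphM; congr (_ * _); have := congr1 (intr : int -> rat) l1.
  rewrite rmorphM /= => l1r; apply: (mulIf (x := (lead_coef q1)%:~R)).
    by apply: contra_eq_neq lq1 => ->; rewrite mulr0 eq_sym oner_eq0.
  by rewrite lq1 mulrC.
exact: intr_int.
Qed.

Lemma map_poly_intr_ratr (R : realType) (p : {poly int}) :
  map_poly (intr : int -> R) p = map_poly ratr (map_poly (intr : int -> rat) p).
Proof.
by rewrite -map_poly_comp; apply: eq_map_poly => z /=; rewrite ratr_int.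
Qed.

Lemma integralOver_ratr (R : realType) (q : rat) :
  integralOver (intr : int -> R) (ratr q) -> q \is a Num.int.
Proof.
case=> p pm; rewrite map_poly_intr_ratr fmorph_root -dvdp_XsubCl.
move=> /(monic_dvdp_int (monicXsubC q) pm)/(_ 0%N).
by rewrite coefB coefX coefC sub0r rpredN.
Qed.

(** The monic quadratic equation of an irrational algebraic number divides, over
    the rationals, every rational polynomial vanishing at that number. *)
Lemma integralOver_quadratic (R : realType) (x : R) (a b : rat) :
    (forall q : rat, x <> ratr q) -> x ^+ 2 - ratr a * x + ratr b = 0 ->
    integralOver (intr : int -> R) x ->
  a \is a Num.int /\ b \is a Num.int.
Proof.
move=> xirr xab [p pm]; rewrite map_poly_intr_ratr.
set P := map_poly intr p => Px.
pose q : {poly rat} := 'X^2 - a *: 'X + b%:P.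
have sr : (size (b%:P - a *: 'X)%R < size ('X^2 : {poly rat}))%N.
  rewrite size_polyXn (leq_ltn_trans (size_polyD _ _)) // gtn_max size_polyN.
  rewrite (leq_ltn_trans (size_polyC_leq1 _)) //.
  by rewrite (leq_ltn_trans (size_scale_leq _ _)) // size_polyX.
have qE : q = 'X^2 + (b%:P - a *: 'X) by rewrite /q addrAC addrA.
have sq : size q = 3 by rewrite qE size_polyDl // size_polyXn.
have qm : q \is monic by rewrite qE monicE lead_coefDl // lead_coefXn.
suff qP : q %| P.
  have hq := monic_dvdp_int qm pm qP; split.
    by have := hq 1%N; rewrite /q !coefE /= mulr1 sub0r addr0 rpredN.
  by have := hq 0%N; rewrite /q !coefE /= mulr0 subr0 add0r.
have q0 : q != 0 by rewrite -size_poly_eq0 sq.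
set r := P %% q.
have sr2 : (size r <= 2)%N by have := ltn_modp P q; rewrite q0 sq.
have rE : r = r`_1 *: 'X + (r`_0)%:P.
  apply/polyP => i; rewrite !coefE; case: i => [|[|i]] /=.
  - by rewrite mulr0 add0r.
  - by rewrite mulr1 addr0.
  - by rewrite mulr0 addr0 (nth_default _ (leq_trans sr2 _)).
have rx : ratr r`_1 * x + ratr r`_0 = 0.
  have : (map_poly ratr r).[x] = 0.
    move: Px; rewrite (divp_eq P q) -/r rmorphD rmorphM /= rootE hornerD hornerM.
    have -> : (map_poly ratr q).[x] = 0.
      rewrite /q rmorphD rmorphB /= map_polyXn map_polyC /= map_polyZ map_polyX.
      by rewrite !hornerE.
    by rewrite mulr0 add0r => /eqP.
  rewrite rE rmorphD /= map_polyC /= map_polyZ map_polyX !hornerE.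
  by rewrite !coefE /= mulr1 mulr0 addr0 add0r.
have r1 : r`_1 = 0.
  apply/eqP/negPn/negP => r1; apply: (xirr (- r`_0 / r`_1)).
  have r1' : ratr r`_1 != 0 :> R by rewrite fmorph_eq0.
  rewrite fmorph_div rmorphN; apply: (mulfI r1').
  by rewrite mulrCA divff // mulr1; apply/eqP; rewrite -addr_eq0 rx.
rewrite /dvdp -/r rE r1 scale0r add0r polyC_eq0.
by move: rx; rewrite r1 rmorph0 mul0r add0r => /eqP; rewrite fmorph_eq0.
Qed.

(** The square of the denominator of [q] divides [d]. *)
Lemma squarefree_sqrM_int (d m : int) (q : rat) : squarefree d ->
  q ^+ 2 * d%:~R = m%:~R -> q \is a Num.int.
Proof.
move=> dsf qd; rewrite Qint_def.
have qdz : numq q ^+ 2 * d = m * denq q ^+ 2.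
  by apply: (intr_inj (R := rat)); rewrite !rmorphM /= -qd numqE; ring.
suff : `|denq q|%N == 1%N by have := denq_gt0 q; lia.
have cop := coprime_num_den q.
have dv : (`|denq q| ^ 2 %| `|d|)%N.
  have : (`|denq q| ^ 2 %| `|numq q| ^ 2 * `|d|)%N.
    by rewrite -!abszX -abszM qdz abszM abszX dvdn_mull.
  by rewrite Gauss_dvdr // coprime_pexpl // coprime_pexpr // coprime_sym.
apply/negPn/negP => n1.
have [|p pp pd] := @pdivP `|denq q|%N; first by have := denq_gt0 q; lia.
by have /negP := dsf _ pp; apply; apply: dvdn_trans dv; rewrite dvdn_pexp2r.
Qed.

(** The unit [e] is irrational, so the monic rational quadratics of [e] and of
    its inverse have integer coefficients.  Their constant terms are inverse to
    each other, so the norm [s] is [1] or [-1].  Then [e = (a + b sqrt d) / 2]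
    with [a = e + s / e] and [b sqrt d = e - s / e], both positive.  The last
    bound turns a bound on [e / sqrt d] into one on [b]. *)
Lemma quad_unit_pell (R : realType) (d : int) (e : R) :
    0 < d -> squarefree d -> quad_unit d e -> 1 < e ->
  exists a b s : int, [/\ [/\ 1 < d, 0 < a & 0 < b], s = 1 \/ s = -1,
    a ^+ 2 = b ^+ 2 * d + 4 * s & b%:~R * Num.sqrt d%:~R <= e + 1].
Proof.
move=> d0 dsf [[r [v eE]] e0 eint eVint] e1.
have dr0 : 0 < d%:~R :> R by rewrite ltr0z.
set w := Num.sqrt _ in eE *.
have w0 : 0 < w by rewrite sqrtr_gt0.
have w2 : w ^+ 2 = d%:~R by rewrite sqr_sqrtr // ltW.
have eirr (q : rat) : e <> ratr q.
  move=> eq; move: eint eVint; rewrite eq -fmorphV.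
  move=> /integralOver_ratr/intrP[n qn] /integralOver_ratr/intrP[n' qn'].
  have q1 : 1 < q by rewrite -(ltr_rat R) rmorph1 -eq.
  have : (n * n')%:~R = 1 :> rat.
    by rewrite rmorphM /= -qn -qn' divff // lt0r_neq0 // (lt_trans ltr01).
  have n1 : 1 < n by rewrite -(ltr_int rat) -qn.
  by move=> /(intr_inj (x2 := 1)); have [n0|n0] := leP n' 0; nia.
pose a := r *+ 2; pose N := r ^+ 2 - v ^+ 2 * d%:~R.
have quad : e ^+ 2 - ratr a * e + ratr N = 0.
  rewrite /N rmorphMn rmorphB rmorphXn rmorphM rmorphXn /= ratr_int -w2 eE.
  by ring.
have N0 : N != 0.
  apply/eqP => z; apply: (eirr a); apply: (mulIf e0).
  by move: quad; rewrite z rmorph0 addr0 expr2 => /eqP; rewrite subr_eq0 => /eqP.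
have Nr0 : ratr N != 0 :> R by rewrite fmorph_eq0.
have quadV : e^-1 ^+ 2 - ratr (a / N) * e^-1 + ratr N^-1 = 0.
  rewrite fmorph_div fmorphV.
  have -> : e^-1 ^+ 2 - ratr a / ratr N * e^-1 + (ratr N)^-1
     = (e ^+ 2 - ratr a * e + ratr N) / (ratr N * e ^+ 2).
    by field; rewrite Nr0 e0.
  by rewrite quad mul0r.
have eVirr (q : rat) : e^-1 <> ratr q.
  by move=> eVq; apply: (eirr q^-1); apply: invr_inj; rewrite eVq fmorphV invrK.
have [/intrP[a' aE] /intrP[s sE]] := integralOver_quadratic eirr quad eint.
have [_ /intrP[s' sE']] := integralOver_quadratic eVirr quadV eVint.
have s1 : s = 1 \/ s = -1.
  have : (s * s')%:~R = 1 :> rat by rewrite rmorphM /= -sE -sE' divff.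
  move=> /(intr_inj (x2 := 1)) ss'.
  have /intUnitRing.unitzPl : s' * s = 1 by rewrite mulrC.
  by rewrite unfold_in /= => /pred2P.
have sr : ratr N = s%:~R :> R by rewrite sE ratr_int.
have ar : ratr a = a'%:~R :> R by rewrite aE ratr_int.
have [b bE] : exists b : int, v *+ 2 = b%:~R.
  apply/intrP; apply: (squarefree_sqrM_int (m := a' ^+ 2 - 4 * s) dsf).
  by rewrite rmorphB rmorphXn rmorphM /= -aE -sE /N /a; ring.
have br : b%:~R = ratr v *+ 2 :> R by rewrite -ratr_int -bE rmorphMn.
have ev : e^-1 < 1 by rewrite invf_lt1 // (lt_trans ltr01).
have ev0 : 0 < e^-1 by rewrite invr_gt0 (lt_trans ltr01).
have aeq : a'%:~R = e + s%:~R * e^-1.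
  apply: (mulIf e0); rewrite mulrDl mulfVK // -ar -sr.
  by move: quad; rewrite expr2 => q; lra.
have beq : b%:~R * w = e - s%:~R * e^-1.
  have -> : b%:~R * w = e *+ 2 - a'%:~R.
    by rewrite br -ar rmorphMn eE /=; ring.
  by rewrite aeq; ring.
have sev : -1 < s%:~R * e^-1 < 1 by case: s1 => ->; rewrite ?rmorphN /=; lra.
exists a', b, s; split=> //.
- split.
  + suff : d != 1 by lia.
    apply/eqP => dE; apply: (eirr (r + v)).
    by rewrite eE /w dE sqrtr1 mulr1 rmorphD.
  + by rewrite -(ltr0z R) aeq; lra.
  + by rewrite -(ltr0z R) -(pmulr_lgt0 _ w0) beq; lra.
- apply: (intr_inj (R := rat)); rewrite rmorphXn rmorphD rmorphM rmorphXn rmorphM /=.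
  by rewrite -aE -bE -sE /N /a; ring.
- by rewrite beq; lra.
Qed.

(** * Periodic continued fractions *)

(** The value of [[u_1; u_2, .., u_r, z]], with a real last entry [z]. *)
Definition contfrac_tail (R : realType) (u : seq int) (z : R) : R :=
  foldr (fun a t => a%:~R + t^-1) z u.

Lemma contfrac_tail_gt0 (R : realType) (u : seq int) (z : R) :
  all (fun a => 0 < a) u -> 0 < z -> 0 < contfrac_tail u z.
Proof.
move=> + z0; elim: u => //= a u IHu /andP[a0 /IHu u0].
by rewrite addr_gt0 ?ltr0z ?invr_gt0.
Qed.

Lemma mulz_ge2_neq1 (C x : int) : 2 <= C -> ~ (C * x = 1 \/ C * x = -1).
Proof.
move=> C2; suff : `|C * x| != 1 by move=> /eqP Cx [] e; apply: Cx; rewrite e.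
rewrite normrM; have [->|x0] := eqVneq x 0; first by rewrite normr0 mulr0.
have : 1 <= `|x| by lia.
have -> : `|C| = C by lia.
by move: `|x| => y y1; apply/eqP; nia.
Qed.

(** Euclid's algorithm on the first column of the matrix [[A, B], [C, E]] of
    determinant [1] or [-1].  The inequalities between the entries survive each
    division step, and force the second column to follow along; at [C = 1] the
    matrix is the one of [[A]] or of [[A - 1, 1]], according to the
    determinant. *)
Lemma contfrac_tail_mobius (R : realType) (A B C E : int) :
    0 <= E -> E <= B -> B <= A -> 1 <= C -> E <= C -> C <= A ->
    (A * E - B * C = 1 \/ A * E - B * C = -1) ->
  exists2 u : seq int, all (fun a => 0 < a) u &
    forall z : R, 0 < z ->
      contfrac_tail u z = (A%:~R * z + B%:~R) / (C%:~R * z + E%:~R).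
Proof.
have [n] := ubnP `|C|%N.
elim: n A B C E => // n IHn A B C E Cn E0 EB BA C1 EC CA det.
have [C2|C2] := leP 2 C; last first.
  have CE : C = 1 by lia.
  have [E1|E1] := eqVneq E 0.
    exists [:: A] => [|z z0]; first by rewrite /= andbT; lia.
    have -> : B = 1 by move: det; rewrite CE E1; lia.
    by rewrite CE E1 /=; field; apply: lt0r_neq0; lra.
  have EE : E = 1 by lia.
  have BE : B = A - 1 by move: det BA; rewrite CE EE; lia.
  exists [:: A - 1; 1] => [|z z0]; first by rewrite /=; lia.
  rewrite CE EE BE /= rmorphB /=; field.
  by apply/andP; split; apply: lt0r_neq0; lra.
pose a := (A %/ C)%Z; pose A' := (A %% C)%Z; pose B' : int := B - a * E.
have AE : A = a * C + A' by rewrite /A' -divz_eq.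
have A'0 : 0 <= A' by rewrite modz_ge0 //; lia.
have A'C : A' < C by rewrite ltz_pmod //; lia.
have a1 : 1 <= a by nia.
have det' : C * B' - E * A' = 1 \/ C * B' - E * A' = -1.
  have -> : C * B' - E * A' = - (A * E - B * C) by rewrite /B' AE; ring.
  by case: det => ->; [right|left].
clearbody a A'.
have A'1 : 1 <= A'.
  suff : A' != 0 by lia.
  by apply/eqP => z; move: det'; rewrite z mulr0 subr0; exact: mulz_ge2_neq1.
have BE : B = a * E + B' by rewrite /B' addrC subrK.
clearbody B'.
have ltEC : E < C.
  suff : E != C by lia.
  by apply/eqP => z; move: det'; rewrite z -mulrBr; exact: mulz_ge2_neq1.
have [||||||||u u0 hu] := IHn C E A' B' => //; try nia.
exists (a :: u) => [|z z0 /=]; first by rewrite /= u0 andbT; lia.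
have [Cr Ar] : 0 < C%:~R :> R /\ 0 < A'%:~R :> R by rewrite !ltr0z; lia.
have [Er Br] : 0 <= E%:~R :> R /\ 0 <= B'%:~R :> R by rewrite !ler0z; nia.
rewrite hu // invf_div AE BE !rmorphD !rmorphM /=; field.
by apply: lt0r_neq0; nra.
Qed.

(** The two denominators [a s + 1] and [a t + 1] are at least [2]. *)
Lemma contfrac_two_steps (R : realType) (a s t : R) : 1 <= a -> 1 <= s -> 1 <= t ->
  `|(a + s^-1)^-1 - (a + t^-1)^-1| <= `|s - t| / 4.
Proof.
move=> a1 s1 t1; have [s0 t0] : 0 < s /\ 0 < t by split; lra.
have [as2 at2] : 2 <= a * s + 1 /\ 2 <= a * t + 1 by split; nra.
have -> : (a + s^-1)^-1 - (a + t^-1)^-1 = (s - t) / ((a * s + 1) * (a * t + 1)).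
  by field; rewrite !lt0r_neq0 //; nra.
rewrite normrM ler_wpM2l // normfV ger0_norm; last by nra.
by rewrite lef_pV2 ?posrE; nra.
Qed.

(** Truncation perturbs the innermost one or two layers by at most [1], and every
    two further layers divide the error by [4]. *)
Lemma contfrac_conv_dist (R : realType) (n : nat) (a : nat -> int) (y : nat -> R) :
    (forall i, 1 <= (a i)%:~R :> R) -> (forall i, 1 <= y i) ->
    (forall i, y i = (a i)%:~R + (y i.+1)^-1) ->
  1 <= contfrac_conv R a n /\ `|contfrac_conv R a n - y 0%N| <= 2 / 2 ^+ n.
Proof.
have [m] := ubnP n; elim: m n a y => // m IHm [|[|n]] a y nm a1 y1 ya /=.
- split=> //; rewrite (ya 0%N) opprD addrA subrr sub0r normrN expr0 divr1.
  rewrite ger0_norm ?invr_ge0 ?(le_trans ler01) //.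
  by rewrite (le_trans (_ : _ <= 1)) ?ler1n // invf_le1 ?(lt_le_trans ltr01).
- have inv01 (t : R) : 1 <= t -> 0 <= t^-1 <= 1.
    by move=> t1; have t0 := lt_le_trans ltr01 t1; rewrite invr_ge0 ltW //= invf_le1.
  have := inv01 _ (a1 1%N); have := inv01 _ (y1 1%N); have := a1 0%N.
  rewrite (ya 0%N) opprD addrACA subrr add0r expr1 divff // /comp.
  move: (_ ^-1) (_ ^-1) => p q; split; first by lra.
  by rewrite ler_norml; lra.
have [c1 cy] := IHm n (a \o succn \o succn) (y \o succn \o succn)
  (ltnW nm) (fun i => a1 i.+2) (fun i => y1 i.+2) (fun i => ya i.+2).
have c0 := lt_le_trans ltr01 c1.
split.
  rewrite ler_wpDr ?a1 // invr_ge0 addr_ge0 ?invr_ge0 ?(le_trans ler01 (a1 _)) //.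
  exact: ltW.
rewrite (ya 0%N) opprD addrACA subrr add0r (ya 1%N).
apply: le_trans (contfrac_two_steps (a1 1%N) c1 (y1 2%N)) _.
apply: le_trans (_ : 2 / 2 ^+ n / 4 <= _).
  by rewrite ler_wpM2r // invr_ge0 ler0n.
have := exprn_gt0 n (ltr0n R 2).
by rewrite !exprS; move: (2 ^+ n) => w w0; rewrite le_eqVlt; apply/orP; left;
   apply/eqP; field; lra.
Qed.

Lemma contfrac_conv_cvg (R : realType) (a : nat -> int) (y : nat -> R) :
    (forall i, 1 <= (a i)%:~R :> R) -> (forall i, 1 <= y i) ->
    (forall i, y i = (a i)%:~R + (y i.+1)^-1) ->
  contfrac_conv R a @ \oo --> y 0%N.
Proof.
move=> a1 y1 ya; apply/cvgrPdist_le => e e0.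
have : geometric 2 2^-1 @ \oo --> (0 : R).
  by apply: cvg_geometric; rewrite ger0_norm ?invf_lt1 ?ltr1n ?invr_ge0.
move=> /cvgr0Pnorm_le/(_ e e0) [N _ hN].
exists N => // n /hN /=; apply: le_trans; rewrite distrC.
have [_ /le_trans] := contfrac_conv_dist n a1 y1 ya; apply.
by rewrite exprVn ler_norm.
Qed.

(** A fixed point [w] of the block [v] is the complete quotient at the start of
    every period; inside a period the complete quotients are the values of the
    final segments of [v] at [w]. *)
Lemma periodic_contfrac (R : realType) (k : int) (v : seq int) (w : R) :
    0 < k -> v != [::] -> all (fun a => 0 < a) v -> 0 < w ->
    contfrac_tail v w = w ->
  is_contfrac (periodic_quotients k v) (k%:~R + w^-1).
Proof.
move=> k0 vn0 v0 w0 vw; have sv : (0 < size v)%N by case: (v) vn0.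
have a0 n : 0 < periodic_quotients k v n.
  by case: n => [|n] //=; apply: (all_nthP 0 v0); rewrite ltn_mod.
split=> [n|]; first exact: a0.
have a1 n : 1 <= (periodic_quotients k v n)%:~R :> R.
  by rewrite ler1z -gtz0_ge1.
pose y n := if n is m.+1 then contfrac_tail (drop (m %% size v) v) w
            else k%:~R + w^-1.
have y0 n : 0 < y n.
  case: n => [|n] /=; first by rewrite addr_gt0 ?ltr0z ?invr_gt0.
  apply: contfrac_tail_gt0 => //.
  by apply/allP => x /mem_drop /(allP v0).
have ya n : y n = (periodic_quotients k v n)%:~R + (y n.+1)^-1.
  case: n => [|n] /=; first by rewrite mod0n drop0 vw.
  have nv : (n %% size v < size v)%N by rewrite ltn_mod.
  rewrite (drop_nth 0 nv) /= modnS; congr (_ + _^-1).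
  have [|//] := ifPn; rewrite {1}(divn_eq n (size v)) -addnS dvdn_addr ?dvdn_mull //.
  by move=> /dvdn_leq vn; rewrite drop0 vw drop_oversize // vn.
apply: (contfrac_conv_cvg (y := y)) => // n.
by rewrite ya (le_trans (a1 n)) // lerDl invr_ge0 ltW.
Qed.

(** Put [z = y + m - t].  Given [y ^ 2 = t y + n], the equation
    [p ^ 2 = t p Q + n Q ^ 2 + s] with [p = Q m + c] says exactly that
    [y = m + (c z + c') / (Q z + c)].  The symmetric matrix [[Q, c], [c, c']]
    has determinant [- s] and expands into a block [u] independent of [m], so
    [y = m + 1 / [u, z]] and [z = 2 m - t + 1 / [u, z]].  The bounds on
    [c] depending on [s] make [c' <= c] and [0 <= c'], as the expansion of the
    matrix requires; the only case left over is the identity matrix, for which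
    [u] is empty. *)
Lemma contfrac_of_unit (R : realType) (t : bool) (Q c c' s : int) :
    s = 1 \/ s = -1 -> 1 <= Q -> 0 <= c <= Q -> (s = 1 -> 1 <= c) ->
    (s = -1 -> c < Q) -> Q * c' = c ^+ 2 - s ->
  exists u : seq int, forall (m : nat) (y n : R), (0 < m)%N -> 0 < y ->
    y ^+ 2 = t%:R * y + n ->
    (Q%:~R * m%:R + c%:~R) ^+ 2 =
      t%:R * (Q%:~R * m%:R + c%:~R) * Q%:~R + n * Q%:~R ^+ 2 + s%:~R ->
    is_contfrac (periodic_quotients m%:Z (rcons u (2 * m%:Z - t%:Z))) y.
Proof.
move=> s1 Q1 /andP[c0 cQ] cs cs' cc'.
have [u u0 hu] : exists2 u : seq int, all (fun a => 0 < a) u &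
    forall z : R, 0 < z ->
      contfrac_tail u z = (Q%:~R * z + c%:~R) / (c%:~R * z + c'%:~R).
  have [c1|c1] := leP 1 c.
    apply: contfrac_tail_mobius => //.
    - by case: s1 cc' => -> cc'; nia.
    - case: s1 cs' cc' => -> cs' cc'; first by nia.
      by have := cs' erefl; nia.
    - case: s1 cs' cc' => -> cs' cc'; first by nia.
      by have := cs' erefl; nia.
    - by case: s1 cc' => -> cc'; [right|left]; lia.
  have cz : c = 0 by lia.
  have sE : s = -1 by case: s1 cs => -> // /(_ erefl); lia.
  have Qc' : Q * c' = 1 by rewrite cc' cz sE.
  have c'1 : 1 <= c' by nia.
  have QE : Q = 1 by nia.
  have c'E : c' = 1 by move: Qc'; rewrite QE mul1r.
  exists [::] => // z z0; rewrite /= QE c'E cz.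
  by rewrite mul1r addr0 mul0r add0r divr1.
exists u => m y n m0 y0 yn pn.
have m1 : 1 <= m%:R :> R by rewrite ler1n.
have Q1r : 1 <= Q%:~R :> R by rewrite ler1z.
have c0r : 0 <= c%:~R :> R by rewrite ler0z.
have cc'r : Q%:~R * c'%:~R = c%:~R ^+ 2 - s%:~R :> R.
  by rewrite -rmorphM cc' rmorphB rmorphXn.
have t1 : t%:R <= 1 :> R by case: (t); rewrite ?ler01.
pose z := y + m%:R - t%:R; have z0 : 0 < z by rewrite /z; lra.
have w0 := contfrac_tail_gt0 u0 z0; set w := contfrac_tail u z in w0.
have Qz0 : 0 < Q%:~R * z + c%:~R by nra.
have cz0 : c%:~R * z + c'%:~R != 0.
  apply: contraTneq w0 => e; rewrite /w hu // e invr0 mulr0.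
  by rewrite ltxx.
have yw : y = m%:R + w^-1.
  rewrite /w hu // invf_div; apply/eqP; rewrite -subr_eq0 opprD addrA subr_eq0.
  rewrite eq_sym; apply/eqP; apply: (canLR (mulfK (lt0r_neq0 Qz0))).
  have Q0 : Q%:~R != 0 :> R by rewrite intr_eq0; lia.
  apply: (mulfI Q0); rewrite mulrDr cc'r.
  have -> : s%:~R = (Q%:~R * m%:R + c%:~R) ^+ 2
    - t%:R * (Q%:~R * m%:R + c%:~R) * Q%:~R - n * Q%:~R ^+ 2 by rewrite pn; ring.
  have -> : n = y ^+ 2 - t%:R * y by rewrite yn; ring.
  by rewrite /z; ring.
rewrite yw (pmulrn 1 m); apply: periodic_contfrac => //.
- by case: (u).
- by rewrite all_rcons u0 andbT; case: (t); lia.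
rewrite /contfrac_tail -cats1 foldr_cat /=; congr foldr.
rewrite rmorphB rmorphM /= -!pmulrn.
have -> : w^-1 = y - m%:R by rewrite yw addrC addKr.
by rewrite /z; ring.
Qed.

(** * Families of Pell equations *)

(** Both kinds of units in one form: with [D' = t + 4 n], which is [D] for odd [b]
    and [4 D] for even [b], the equation reads
    [(2 p - t Q) ^ 2 = Q ^ 2 D' + 4 s].  If [b] is odd then so is [a], since otherwise
    [4] would divide [D]. *)
Lemma squarefree_pell_parity (b D a s : int) : squarefree D ->
    a ^+ 2 = b ^+ 2 * D + 4 * s ->
  exists (t : bool) (Q n p : int),
    [/\ b = (if t then Q else 2 * Q), D = (if t then 1 + 4 * n else n),
        a = 2 * p - t%:Z * Q & t = odd `|b|%N].
Proof.
move=> Dsf ab.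
have D4 z : D <> 4 * z.
  by move=> Dz; have /negP := Dsf 2 isT; apply; rewrite Dz abszM dvdn_mulr.
have even_or_odd (z : int) : exists w, z = 2 * w + (odd `|z|%N)%:Z.
  by exists (z %/ 2)%Z; rewrite {1}(divz_eq z 2) mulrC; lia.
have [b' bE] := even_or_odd b; have [a' aE] := even_or_odd a.
case: (odd `|b|%N) bE => bE; last first.
  have {}bE : b = 2 * b' by lia.
  exists false, b', D, a'; split=> //; case: (odd `|a|%N) aE => aE; last by lia.
  have : 4 * (a' ^+ 2 + a' - b' ^+ 2 * D - s) = - 1 by move: ab; rewrite aE bE /=; lia.
  by lia.
have {}bE : b = 2 * b' + 1 by lia.
case: (odd `|a|%N) aE => aE; last first.
  have {}aE : a = 2 * a' by lia.
  case: (D4 (a' ^+ 2 - s - (b' ^+ 2 + b') * D)); move: ab.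
  by rewrite aE bE; lia.
have {}aE : a = 2 * a' + 1 by lia.
exists true, b, (a' ^+ 2 + a' - (b' ^+ 2 + b') * D - s), (a' + b' + 1); split=> //.
- by move: ab; rewrite aE bE; lia.
- by rewrite aE bE /=; lia.
Qed.

(** The residue [c] of [p] modulo [Q] is taken in [1, Q] for norm [1] and in
    [0, Q - 1] for norm [-1], which makes the length of the period even or odd
    as the norm requires.  The quotient stays positive because [p > Q],
    respectively [p >= Q]. *)
Lemma pell_residue (t : bool) (Q n p s : int) :
    s = 1 \/ s = -1 -> 1 <= Q -> (if t then 1 else 2) <= n ->
    0 < 2 * p - t%:Z * Q ->
    (2 * p - t%:Z * Q) ^+ 2 = Q ^+ 2 * (t%:Z + 4 * n) + 4 * s ->
  exists c c' m : int, [/\ p = Q * m + c, 0 < m, 0 <= c <= Q,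
    (s = 1 -> 1 <= c) /\ (s = -1 -> c < Q) & Q * c' = c ^+ 2 - s].
Proof.
move=> s1 Q1 n1 a0 aE.
have pE : p ^+ 2 = t%:Z * p * Q + n * Q ^+ 2 + s.
  by case: t aE {n1 a0} => /=; lia.
have nQ : (if t then 1 else 2) * Q ^+ 2 <= n * Q ^+ 2 by rewrite ler_wpM2r ?sqr_ge0.
have Q2 : 1 <= Q ^+ 2 by rewrite expr2; nia.
have p_gt : s = 1 -> Q < p.
  move=> sE; rewrite ltNge; apply/negP => pQ.
  by case: t pE a0 nQ {aE n1}; rewrite sE /= => pE a0 nQ; nia.
have p_ge : s = -1 -> Q <= p.
  move=> sE; rewrite leNgt; apply/negP => pQ.
  by case: t pE a0 nQ {aE n1}; rewrite sE /= => pE a0 nQ; nia.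
have [c [m [pm m0 c0 cs]]] : exists c m : int, [/\ p = Q * m + c, 0 < m, 0 <= c <= Q &
    (s = 1 -> 1 <= c) /\ (s = -1 -> c < Q)].
  have div z : Q <= z -> exists c m : int, [/\ z = Q * m + c, 0 < m & 0 <= c < Q].
    move=> Qz; exists (z %% Q)%Z, (z %/ Q)%Z.
    have c0 : 0 <= (z %% Q)%Z by rewrite modz_ge0 //; lia.
    have cQ : (z %% Q)%Z < Q by rewrite ltz_pmod //; lia.
    have zE : z = Q * (z %/ Q)%Z + (z %% Q)%Z by rewrite mulrC -divz_eq.
    by split=> //; [nia|apply/andP].
  case: s1 => sE.
    have [|c [m [pm m0 /andP[c0 cQ]]]] := div (p - 1); first by have := p_gt sE; lia.
    by exists (c + 1), m; split=> //; lia.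
  have [c [m [pm m0 /andP[c0 cQ]]]] := div p (p_ge sE).
  by exists c, m; split=> //; lia.
exists c, (t%:Z * p + n * Q - 2 * p * m + Q * m ^+ 2), m; split=> //.
rewrite (_ : c = p - Q * m); last by rewrite pm; ring.
by rewrite sqrrB pE; ring.
Qed.

Lemma half_trace_quadratic (R : rcfType) (t : bool) (d : R) : 0 <= d ->
  let y := if t then (1 + Num.sqrt d) / 2 else Num.sqrt d in
  y ^+ 2 = t%:R * y + (if t then (d - 1) / 4 else d).
Proof.
move=> d0; have := sqr_sqrtr d0; move: (Num.sqrt d) => w wd; rewrite -wd.
by case: t => /=; field.
Qed.

(** The sign of [G(x)] and the residue [c] are fixed by the pigeonhole principle.
    For the resulting [k], the condition [k(x) = m] amounts to
    [+-G(x) = 2 (Q m + c) - t Q], so that the square of the right-hand side is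
    [b ^ 2 D(x) + 4 s] also at the [x] outside the given infinite set. *)
Lemma sqrt_pell_family (R : realType) (D : {poly int}) (b s : int) (G : {poly rat}) :
    0 < b -> s = 1 \/ s = -1 ->
    G ^+ 2 = map_poly intr ((b ^+ 2)%:P * D + (4 * s)%:P) ->
    inf_often (fun x => [/\ (0 < x)%N, 1 < D.[x%:Z], squarefree D.[x%:Z] &
      exists2 a : int, 0 < a & a ^+ 2 = b ^+ 2 * D.[x%:Z] + 4 * s]) ->
  exists (k : {poly rat}) (u : seq int),
    infinite_set [set x : nat | exists m : nat, admissible D k x m] /\
    ((forall x m : nat, admissible D k x m ->
        is_contfrac (periodic_quotients m%:Z (rcons u (2 * m%:Z)))
          (Num.sqrt (D.[x%:Z])%:~R : R)) \/
     (forall x m : nat, admissible D k x m ->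
        is_contfrac (periodic_quotients m%:Z (rcons u (2 * m%:Z - 1)))
          ((1 + Num.sqrt (D.[x%:Z])%:~R) / 2 : R))).
Proof.
move=> b0 s1 GE hx.
pose t := odd `|b|%N; pose Q := if t then b else (b %/ 2)%Z.
have bE : b = if t then Q else 2 * Q.
  by rewrite /Q /t; case ob: (odd _) => //; lia.
have Q1 : 1 <= Q by move: bE; case: (t); lia.
have Gx (x : nat) : G.[x%:R] ^+ 2 = (b ^+ 2 * D.[x%:Z] + 4 * s)%:~R.
  have -> : x%:R = (x%:Z)%:~R :> rat by rewrite -pmulrn.
  by rewrite -horner_exp GE horner_map hornerD hornerM !hornerC.
pose val (x : nat) (tau : bool) (c m : int) :=
  (-1) ^+ tau * G.[x%:R] = (2 * (Q * m + c) - t%:Z * Q)%:~R.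
pose cond (c : int) := [/\ 0 <= c <= Q,
  (s = 1 -> 1 <= c) /\ (s = -1 -> c < Q) & exists c', Q * c' = c ^+ 2 - s].
have [[tau c] hi] : exists i : bool * 'I_(`|Q|%N.+1), inf_often (fun x =>
    [/\ (0 < x)%N, 0 < D.[x%:Z], cond (i.2 : nat) &
        exists2 m : nat, (0 < m)%N & val x i.1 (i.2 : nat) m]).
  apply: (inf_often_pigeonhole hx) => x [x0 Dx1 Dsf [a a0 ab]].
  have [t' [Q' [n [p [bE' DE aE t'E]]]]] := squarefree_pell_parity Dsf ab.
  have tt' : t' = t by rewrite t'E.
  have QQ' : Q' = Q by move: bE bE'; rewrite tt'; case: (t); lia.
  move: DE aE; rewrite {}tt' {}QQ' => DE aE.
  have [|||c [c' [m [pm m0 c0 cs cc']]]] := @pell_residue t Q n p s s1 Q1.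
  - by move: DE; case: (t); lia.
  - by rewrite -aE.
  - by rewrite -aE ab bE DE; case: (t) => /=; lia.
  have cQ : (`|c|%N < `|Q|%N.+1)%N by lia.
  have cabs : (`|c|%N : int) = c by lia.
  have /orP[Ga|Ga] : (G.[x%:R] == a%:~R) || (G.[x%:R] == - a%:~R).
    by rewrite -eqf_sqr Gx -ab -rmorphXn.
  - exists (false, Ordinal cQ); split=> //=; first by lia.
      by rewrite cabs; split=> //; exists c'.
    exists `|m|%N; first by lia.
    by rewrite /val expr0 mul1r (eqP Ga) aE pm cabs gez0_abs // ltW.
  - exists (true, Ordinal cQ); split=> //=; first by lia.
      by rewrite cabs; split=> //; exists c'.
    exists `|m|%N; first by lia.
    by rewrite /val expr1 mulN1r (eqP Ga) opprK aE pm cabs gez0_abs // ltW.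
have [x0 _ [_ _ [c0 [cs cs'] [c' cc']] _]] := hi 0%N.
have Qr : Q%:~R != 0 :> rat by rewrite intr_eq0; lia.
pose k : {poly rat} := (2 * Q%:~R)^-1 *:
  ((-1) ^+ tau *: G + ((t%:Z * Q - 2 * (c : nat)%:Z)%:~R)%:P).
have kE (x m : nat) : k.[x%:R] = m%:R <-> val x tau (c : nat) m.
  rewrite /k /val hornerZ hornerD hornerZ hornerC; move: (_ * G.[_]) => g.
  have -> : (2 * (Q * m%:Z + (c : nat)%:Z) - t%:Z * Q)%:~R
      = 2 * Q%:~R * m%:R - (t%:Z * Q - 2 * (c : nat)%:Z)%:~R :> rat.
    by rewrite !(rmorphB, rmorphD, rmorphM) /= -!pmulrn; ring.
  by move: ((_ - _)%:~R) => v; split=> [<-|->]; field.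
have [u hu] := contfrac_of_unit R t s1 Q1 c0 cs cs' cc'.
exists k, u; split.
  apply: inf_often_infinite; apply: inf_often_impl hi => x [xp Dp _ [m mp xm]].
  by exists m; split=> //; apply/kE.
have cf (x m : nat) : admissible D k x m ->
    is_contfrac (periodic_quotients m%:Z (rcons u (2 * m%:Z - t%:Z)))
      (if t then (1 + Num.sqrt (D.[x%:Z])%:~R) / 2
       else Num.sqrt (D.[x%:Z])%:~R : R).
  move=> [xp Dp mp /kE xm].
  have Dr : 0 < (D.[x%:Z])%:~R :> R by rewrite ltr0z.
  apply: hu (half_trace_quadratic t (ltW Dr)) _ => //.
    by have := Dr; rewrite -sqrtr_gt0; case: (t) => //; lra.
  have : (2 * (Q * m%:Z + (c : nat)%:Z) - t%:Z * Q) ^+ 2 = b ^+ 2 * D.[x%:Z] + 4 * s.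
    apply: (intr_inj (R := rat)); rewrite -Gx rmorphXn /= -xm exprMn.
    by rewrite sqrr_sign mul1r.
  move=> /(congr1 (intr : int -> R)); rewrite bE.
  move: (D.[_]) => d; case: (t) => /=;
    rewrite !(rmorphB, rmorphD, rmorphXn, rmorphM) /= -?pmulrn => e; lra.
by case: (t) cf => cf; [right|left] => x m /cf; rewrite ?subr0.
Qed.

Theorem proposition9 (R : realType) (D : {poly int})
    (hD : exists2 C : R, 0 < C &
      positive_density R [set x : nat |
        [/\ (0 < x)%N, 0 < D.[x%:Z], squarefree D.[x%:Z] &
            exists2 e : R, fundamental_unit D.[x%:Z] e &
              e <= C * Num.sqrt (D.[x%:Z])%:~R]]) :
  exists (k : {poly rat}) (u : seq int),
    infinite_set [set x : nat | exists m : nat, admissible D k x m] /\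
    ((forall x m : nat, admissible D k x m ->
        is_contfrac (periodic_quotients m%:Z (rcons u (2 * m%:Z)))
          (Num.sqrt (D.[x%:Z])%:~R : R)) \/
     (forall x m : nat, admissible D k x m ->
        is_contfrac (periodic_quotients m%:Z (rcons u (2 * m%:Z - 1)))
          ((1 + Num.sqrt (D.[x%:Z])%:~R) / 2 : R))).
Proof.
have [C C0] := hD; set S := [set x | _] => Sdens.
pose B := Num.bound (C + 1); pose sgn (z : bool) : int := if z then 1 else -1.
have pell x : exists i : 'I_B * bool, S x -> [/\ 1 < D.[x%:Z], 0 < (i.1 : nat)%:Z &
    exists2 a : int, 0 < a & a ^+ 2 = (i.1 : nat)%:Z ^+ 2 * D.[x%:Z] + 4 * sgn i.2].
  have [Sx|nSx] := pselect (S x); last first.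
    have B0 : (0 < B)%N by rewrite -(ltr_nat R) (le_lt_trans _ (archi_boundP _)) //; lra.
    by exists (Ordinal B0, true).
  have [x0 Dx0 Dsf [e [eunit e1 _] eC]] := Sx.
  have [a [b [s [[Dx1 a0 b0] s1 ab be]]]] := quad_unit_pell Dx0 Dsf eunit e1.
  have w1 : 1 <= Num.sqrt (D.[x%:Z])%:~R :> R.
    by rewrite -[leLHS]sqrtr1 ler_sqrt ?ler1z ?ler0z ?ltW.
  have bC : b%:~R <= C + 1 by rewrite -(ler_pM2r (lt_le_trans ltr01 w1)); lra.
  have bB : (`|b|%N < B)%N.
    rewrite -(ltr_nat R) pmulrn gez0_abs ?ltW //.
    by apply: le_lt_trans bC (archi_boundP _); lra.
  have babs : (`|b|%N : int) = b by lia.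
  exists (Ordinal bB, s == 1) => _; rewrite /= babs; split=> //.
  by exists a => //; rewrite ab; case: s1 => ->.
have [f hf] := choice pell.
have [[b z] [h [h0 pairs]]] := positive_density_pair f Sdens.
pose F : {poly int} := ((b : nat)%:Z ^+ 2)%:P * D + (4 * sgn z)%:P.
have [|G GE] := @square_poly_of_pairs F h h0.
  have FE x : S x -> f x = (b, z) -> exists a : int, F.[x%:Z] = a ^+ 2.
    move=> /hf + fx; rewrite fx /= => -[_ _ [a _ aE]]; exists a.
    by rewrite aE hornerD hornerM !hornerC.
  by apply: inf_often_impl pairs => x [Sx Sxh fx fxh]; split; apply: FE.
have good x : S x -> f x = (b, z) -> [/\ (0 < x)%N, 1 < D.[x%:Z], squarefree D.[x%:Z] &
    exists2 a : int, 0 < a & a ^+ 2 = (b : nat)%:Z ^+ 2 * D.[x%:Z] + 4 * sgn z].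
  move=> Sx fx; have := hf x Sx; rewrite fx => -[Dx1 _ aE].
  by have [x0 _ Dsf _] := Sx.
apply: (@sqrt_pell_family R D b (sgn z) G).
- have [x _ [Sx _ fx _]] := pairs 0%N.
  by have := hf x Sx; rewrite fx => -[].
- by case: (z); [left|right].
- by rewrite -GE.
- by apply: inf_often_impl pairs => x [Sx _ fx _]; apply: good.
Qed.
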